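(* In the $5x+1$ repeated random walk model, with probability one the quantities $t^-(n,\omega)=\inf\{e^{Z_{k,n}}:k\ge0\}$ are finite for every $n\ge1$. Moreover, with probability one, $$\liminf_{n\to\infty}\frac{\log t^-(n,\omega)}{\log n}=\liminf_{n\to\infty}\Big(\inf_{k\ge0}\frac{Z_{k,n}}{\log n}\Big)=1-\frac{1}{\theta^*},$$ where $\theta^*$ is the larger of the two real roots of $M_{5,RRW}(\theta)=1$, with $M_{5,RRW}(\theta)=\tfrac12\big(2^\theta+(\tfrac25)^\theta\big)$ (numerically $\theta^*\approx 0.3490813$ and $1-1/\theta^*\approx-1.86466$).
   Context: The $5x+1$ repeated random walk (RRW) model: for each integer $n\ge1$ take an independent sequence $(\delta_{i,n})_{i\ge1}$ of i.i.d. Bernoulli random variables with $\mathbb P[\delta=0]=\mathbb P[\delta=1]=\tfrac12$ (all sequences mutually independent), put $W_{i,n}=-\log 2+\delta_{i,n}\log 5$, and define $Z_{0,n}=\log n$, $Z_{k,n}=\log n+W_{1,n}+\cdots+W_{k,n}$. A realization is $\omega=\{Z_{k,n}\}$. The equation $M_{5,RRW}(\theta)=1$ has the root $\theta=0$ and one positive root. *)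

(* Defs.v *)
From mathcomp Require Import all_boot all_order all_algebra.
From mathcomp Require Import finmap.
From mathcomp Require Import all_classical all_reals all_analysis.

Set Implicit Arguments.
Unset Strict Implicit.
Unset Printing Implicit Defensive.

Import Order.TTheory GRing.Theory Num.Theory.
Import numFieldNormedType.Exports.

Local Open Scope classical_set_scope.
Local Open Scope ring_scope.

Definition fair_bernoulli (R : realType) (d : measure_display)
    (T : measurableType d) (P : probability T R) (X : {RV P >-> R}) : Prop :=
  P (X @^-1` [set 0]) = (2^-1)%:E /\ P (X @^-1` [set 1]) = (2^-1)%:E.

Definition mutually_independent (R : realType) (d : measure_display)
    (T : measurableType d) (P : probability T R) (I : choiceType)
    (D : set I) (X : I -> {RV P >-> R}) : Prop :=
  forall (J : {fset I}) (B : I -> set R),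
    [set` J] `<=` D ->
    (forall j, j \in J -> measurable (B j)) ->
    P (\bigcap_(j in [set` J]) X j @^-1` B j) =
      (\prod_(j <- J) P (X j @^-1` B j))%E.

(* [delta i n] is the i-th step of the walk started at log n; both indices run
   from 1, and nothing is assumed about delta when an index is 0. *)
Definition rrw_model (R : realType) (d : measure_display)
    (T : measurableType d) (P : probability T R)
    (delta : nat -> nat -> {RV P >-> R}) : Prop :=
  (forall i n, (0 < i)%N -> (0 < n)%N -> fair_bernoulli (delta i n)) /\
  mutually_independent [set p : nat * nat | (0 < p.1)%N /\ (0 < p.2)%N]
    (fun p => delta p.1 p.2).

Section Walk.
Variables (R : realType) (d : measure_display) (T : measurableType d).
Variables (P : probability T R) (delta : nat -> nat -> {RV P >-> R}).

Definition W5 (i n : nat) (w : T) : R := - ln 2 + delta i n w * ln 5.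

Definition Z5 (k n : nat) (w : T) : R :=
  ln n%:R + \sum_(1 <= i < k.+1) W5 i n w.

Definition t_minus (n : nat) (w : T) : \bar R :=
  ereal_inf [set (expR (Z5 k n w))%:E | k in [set: nat]].

End Walk.

Definition M5_RRW (R : realType) (theta : R) : R :=
  2^-1 * (2 `^ theta + (2 / 5) `^ theta).

(* Main.v *)
Require Import Defs.
From mathcomp Require Import all_boot all_order all_algebra.
From mathcomp Require Import finmap.
From mathcomp Require Import all_classical all_reals all_analysis.
From mathcomp Require Import ring lra.

Set Implicit Arguments.
Unset Strict Implicit.
Unset Printing Implicit Defensive.

Import Order.TTheory GRing.Theory Num.Theory.
Import numFieldNormedType.Exports.

Local Open Scope classical_set_scope.
Local Open Scope ring_scope.

(** Up to a null set, the first k steps of a walk are described by the set of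
    its upward steps, a uniform subset of 'I_k, and the walk has then fallen by
    k ln 2 - b ln 5, where b is the size of that set. Both halves of the theorem
    are applications of the first Borel-Cantelli lemma.

    Lower bound: by exponential Markov, a fall of at least x after k steps has
    probability at most e^(- t x) M(t)^k. Strict convexity of M gives M(t) < 1
    for 0 < t < theta*, so summing over k bounds the probability that the walk
    from n ever falls by g ln n by a constant times n^(- t g). For g > 1/theta*
    some such t has t g > 1, which makes this summable in n.

    Upper bound: let p = (2/5)^theta* / 2, the probability of an upward step
    under the law tilted by theta*, and mu = ln 2 - p ln 5 = M'(theta* ) > 0.
    The mode b of the binomial law (k, p) has mass at least 1/(k+1) and is
    within 1 of (k+1) p. Undoing the tilt, a walk falls by k mu - ln 5 in k
    steps with probability at least of order e^(- theta* k mu) / (k+1). Among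
    about e^(k beta) independent walks, with beta slightly larger than
    theta* mu, the probability that none does is summable in k. *)

Section ExponentialBounds.
Context {R : realType}.
Implicit Types (a l r t x : R) (n i : nat).

(* Horner form of the Taylor expansion, with r in place of the tail: unlike the
   sum over factorials, it can be evaluated on concrete decimals. *)
Fixpoint exp_horner x n i r : R :=
  if n is m.+1 then 1 + x / i%:R * exp_horner x m i.+1 r else r.

Lemma exp_horner_sum x n i r :
  exp_horner x n i.+1 r =
  \sum_(j < n) x ^+ j * (i`!%:R / (i + j)`!%:R) +
  x ^+ n * (i`!%:R / (i + n)`!%:R) * r.
Proof.
have fact_neq0 m : m`!%:R != 0 :> R by rewrite pnatr_eq0 -lt0n fact_gt0.
elim: n i => [|n IHn] i /=.
  by rewrite big_ord0 add0r expr0 addn0 divff ?mul1r.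
have shift j : x / i.+1%:R * (x ^+ j * (i.+1`!%:R / (i.+1 + j)`!%:R)) =
    x ^+ j.+1 * (i`!%:R / (i + j.+1)`!%:R) :> R.
  by rewrite addSnnS factS natrM exprS -[_ * _ / _]mulrA
    [X in _ * X]mulrCA !mulrA divfK.
rewrite IHn big_ord_recl /= expr0 addn0 divff// mul1r mulrDr mulrA shift -addrA.
by rewrite mulr_sumr; congr (_ + (_ + _)); apply: eq_bigr => j _; rewrite shift.
Qed.

Lemma exp_horner_series x n r :
  exp_horner x n 1 r = series (exp_coeff x) n + exp_coeff x n * r.
Proof.
rewrite exp_horner_sum /series /= big_mkord /exp_coeff /= fact0 add0n mul1r.
by under eq_bigr do rewrite add0n mul1r.
Qed.

Lemma le_exp_horner x n i : 0 <= x -> {homo exp_horner x n i : r s / r <= s}.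
Proof.
move=> x0 r s rs; elim: n i => [|n IHn] i //=.
by rewrite lerD2l ler_wpM2l// divr_ge0.
Qed.

Lemma series_exp_coeff_le_expR x n : 0 <= x -> series (exp_coeff x) n <= expR x.
Proof.
move=> x0; apply: nondecreasing_cvgn_le; last exact: is_cvg_series_exp_coeff.
by apply: nondecreasing_series => k _ _; exact: exp_coeff_ge0.
Qed.

Lemma exp_horner_le_expR x n : 0 <= x -> exp_horner x n 1 1 <= expR x.
Proof.
move=> x0; rewrite exp_horner_series mulr1.
by rewrite (le_trans _ (series_exp_coeff_le_expR n.+1 x0))// seriesSr.
Qed.

Lemma exp_coeffD_le x n j : 0 <= x ->
  exp_coeff x (n + j)%N <= exp_coeff x n * exp_coeff x j.
Proof.
move=> x0; rewrite /exp_coeff /= mulf_div -exprD ler_wpM2l ?exprn_ge0//.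
rewrite lef_pV2 ?posrE -?natrM ?ltr0n ?muln_gt0 ?fact_gt0// ler_nat.
rewrite -(bin_fact (leq_addr j n)) addKn -[leqLHS]mul1n leq_mul2r.
by rewrite bin_gt0 leq_addr orbT.
Qed.

Lemma expR_le_exp_horner x n r : 0 <= x -> expR x <= r ->
  expR x <= exp_horner x n 1 r.
Proof.
move=> x0 xr; apply: le_trans (le_exp_horner n 1 x0 xr).
rewrite exp_horner_series; apply: limr_le; first exact: is_cvg_series_exp_coeff.
near=> N.
have nN : (n <= N)%N by near: N; exact: nbhs_infty_ge.
rewrite -lerBlDl sub_series_geq//.
have := ler_wpM2l (exp_coeff_ge0 n x0) (series_exp_coeff_le_expR (N - n) x0).
apply: le_trans; rewrite /series /= mulr_sumr -{1}[n]add0n big_addn.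
by apply: ler_sum => j _; rewrite addnC exp_coeffD_le.
Unshelve. all: by end_near. Qed.

Lemma expR1_le3 : expR 1 <= 3 :> R.
Proof.
by have := expR_le_exp_horner 3 ler01 (lexx (expR (1 : R))) => /=; lra.
Qed.

Lemma expR_le_exp_horner3 x n : 0 <= x <= 1 -> expR x <= exp_horner x n 1 3.
Proof.
move=> /andP[x0 x1]; apply: expR_le_exp_horner => //.
by apply: le_trans expR1_le3; rewrite ler_expR.
Qed.

Lemma ln_le_of_exp_horner a l n : 0 <= l -> 0 < a <= exp_horner l n 1 1 ->
  ln a <= l.
Proof.
move=> l0 /andP[a0 al]; rewrite -ler_expR lnK ?posrE//.
exact: le_trans al (exp_horner_le_expR n l0).
Qed.

Lemma ln_ge_of_exp_horner a l n : 0 <= l <= 1 -> 0 < a ->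
  exp_horner l n 1 3 <= a -> l <= ln a.
Proof.
move=> l01 a0 la; rewrite -ler_expR lnK ?posrE//.
exact: le_trans (expR_le_exp_horner3 n l01) la.
Qed.

Lemma powR_le_exp_horner a t l n : 0 < a -> 0 <= t -> ln a <= l ->
  0 <= t * l <= 1 -> a `^ t <= exp_horner (t * l) n 1 3.
Proof.
move=> a0 t0 al tl; apply: le_trans (expR_le_exp_horner3 n tl).
by rewrite /powR gt_eqF// ler_expR ler_wpM2l.
Qed.

Lemma powR_ge_exp_horner a t l n : 0 < a -> 0 <= t -> 0 <= l <= ln a ->
  exp_horner (t * l) n 1 1 <= a `^ t.
Proof.
move=> a0 t0 /andP[l0 al].
apply: le_trans (exp_horner_le_expR n (mulr_ge0 t0 l0)) _.
by rewrite /powR gt_eqF// ler_expR ler_wpM2l.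
Qed.

Lemma expRN_le_inv x : 0 < x -> expR (- x) <= x^-1.
Proof.
move=> x0; rewrite expRN lef_pV2 ?posrE ?expR_gt0//.
by apply: le_trans (expR_ge1Dx x); rewrite lerDr.
Qed.

Lemma natS_le_expR x n : 0 < x -> n.+1%:R <= (1 + x^-1) * expR (n%:R * x).
Proof.
move=> x0; have c0 : 0 <= 1 + x^-1 by rewrite addr_ge0// invr_ge0 ltW.
apply: le_trans (ler_wpM2l c0 (expR_ge1Dx _)).
rewrite mulrDl mul1r mulrDr mulr1 mulrCA mulVf ?gt_eqF// mulr1 -natr1.
have xV_ge0 : 0 <= x^-1 by rewrite invr_ge0 ltW.
by have := mulr_ge0 (ler0n R n) (ltW x0); lra.
Qed.

End ExponentialBounds.

Section MomentFunction.
Context {R : realType}.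
Implicit Types (a x y t : R).

Lemma powR_tangent_lt a x y : 0 < a -> a != 1 -> x != y ->
  a `^ y * (1 + (x - y) * ln a) < a `^ x.
Proof.
move=> a0 a1 xy.
have lna0 : ln a != 0 by rewrite ln_eq0.
have -> : a `^ x = a `^ y * expR ((x - y) * ln a).
  by rewrite /powR gt_eqF// -expRD -mulrDl addrC subrK.
by rewrite ltr_pM2l ?powR_gt0// expR_gt1Dx// mulf_neq0// subr_eq0.
Qed.

Definition M5_slope t : R :=
  2^-1 * (ln 2 * 2 `^ t + ln (2 / 5) * (2 / 5) `^ t).

Lemma M5_0 : M5_RRW 0 = 1 :> R.
Proof. by rewrite /M5_RRW !powRr0; lra. Qed.

Lemma M5_gt0 t : 0 < M5_RRW t.
Proof. by rewrite mulr_gt0// addr_gt0// powR_gt0//; lra. Qed.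

Lemma M5_tangent_lt x y : x != y ->
  M5_RRW y + M5_slope y * (x - y) < M5_RRW x.
Proof.
move=> xy; rewrite /M5_RRW /M5_slope.
have : 2 `^ y * (1 + (x - y) * ln 2) < 2 `^ x.
  by apply: powR_tangent_lt => //; rewrite gt_eqF//; lra.
have : (2 / 5) `^ y * (1 + (x - y) * ln (2 / 5)) < (2 / 5) `^ x.
  by apply: powR_tangent_lt => //; rewrite lt_eqF//; lra.
by lra.
Qed.

Lemma M5_lt1 t x : M5_RRW t = 1 -> 0 < x < t -> M5_RRW x < 1.
Proof.
move=> Mt /andP[x0 xt].
have := @M5_tangent_lt 0 x; rewrite lt_eqF// M5_0 => /(_ isT) above0.
have := @M5_tangent_lt t x; rewrite gt_eqF// Mt => /(_ isT) abovet.
have : x * (M5_RRW x + M5_slope x * (t - x)) < x * 1 by rewrite ltr_pM2l.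
have : (t - x) * (M5_RRW x + M5_slope x * (0 - x)) < (t - x) * 1.
  by rewrite ltr_pM2l// subr_gt0.
move=> ? ?; have : t * M5_RRW x < t * 1 by lra.
by rewrite ltr_pM2l// (lt_trans x0).
Qed.

Lemma M5_slope_gt0 t : 0 < t -> M5_RRW t = 1 -> 0 < M5_slope t.
Proof.
move=> t0 Mt; have := @M5_tangent_lt 0 t; rewrite lt_eqF// M5_0 Mt => /(_ isT).
by rewrite gtrDl sub0r mulrN oppr_lt0 pmulr_lgt0.
Qed.

Lemma M5_no_three_roots x y z : x < y < z ->
  M5_RRW x = 1 -> M5_RRW y = 1 -> M5_RRW z = 1 -> False.
Proof.
move=> /andP[xy yz] Mx My Mz.
have := @M5_tangent_lt x y; rewrite lt_eqF// Mx My gtrDl => /(_ isT).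
rewrite nmulr_llt0 ?subr_lt0// => slope_gt0.
have := @M5_tangent_lt z y; rewrite gt_eqF// Mz My gtrDl => /(_ isT).
by rewrite pmulr_rlt0// subr_lt0 ltNge ltW.
Qed.

Lemma M5_roots t : 0 < t -> M5_RRW t = 1 ->
  forall x, M5_RRW x = 1 <-> x = 0 \/ x = t.
Proof.
move=> t0 Mt x; split=> [Mx|[->|->]//]; last exact: M5_0.
have [x0|x0|->] := ltgtP x 0; last by left.
  by case: (@M5_no_three_roots x 0 t); rewrite ?x0 ?M5_0.
have [xt|xt|->] := ltgtP x t; last by right.
  by case: (@M5_no_three_roots 0 x t); rewrite ?x0 ?M5_0.
by case: (@M5_no_three_roots 0 t x); rewrite ?t0 ?M5_0.
Qed.

Lemma continuous_powR a : 0 < a -> continuous (powR a).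
Proof.
move=> a0 t; rewrite /powR gt_eqF//.
by apply: continuous_comp; [exact: mulrr_continuous|exact: continuous_expR].
Qed.

Lemma continuous_M5 : continuous (@M5_RRW R).
Proof.
move=> t; apply: cvgMl_tmp.
by apply: cvgD; apply: continuous_powR; lra.
Qed.

End MomentFunction.

Section RootLocation.
Context {R : realType}.
Implicit Types (t : R) (s : seq nat).

(* Grouping the decimals by three keeps the unary numerals small. *)
Definition thousandths s : R :=
  foldr (fun d r => (d%:R + r) / 10 ^+ 3) 0 s.

Lemma ln2_itv : thousandths [:: 693; 147; 180; 500]%N <= ln 2
  <= thousandths [:: 693; 147; 180; 600]%N.
Proof.
apply/andP; split; rewrite /thousandths /=.
  by apply: (@ln_ge_of_exp_horner _ _ _ 13) => //=; lra.
by apply: (@ln_le_of_exp_horner _ _ _ 12) => /=; lra.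
Qed.

Lemma ln52_itv : thousandths [:: 916; 290; 731; 800]%N <= ln (5 / 2)
  <= thousandths [:: 916; 290; 731; 900]%N.
Proof.
apply/andP; split; rewrite /thousandths /=.
  by apply: (@ln_ge_of_exp_horner _ _ _ 15) => /=; lra.
by apply: (@ln_le_of_exp_horner _ _ _ 13) => /=; lra.
Qed.

Lemma M5E t : M5_RRW t = 2^-1 * (2 `^ t + ((5 / 2) `^ t)^-1).
Proof. by rewrite -powRN -mulN1r powRrM powR_inv1// invf_div. Qed.

Let powR52_gt0 t : 0 < (5 / 2) `^ t :> R.
Proof. by rewrite powR_gt0//; lra. Qed.

Lemma M5_lt1E t : (M5_RRW t < 1) = (1 < (2 - 2 `^ t) * (5 / 2) `^ t).
Proof. by rewrite M5E -ltr_pdivrMr// div1r ltrBrDl ltr_pdivrMl// mulr1. Qed.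

Lemma M5_gt1E t : (1 < M5_RRW t) = ((2 - 2 `^ t) * (5 / 2) `^ t < 1).
Proof. by rewrite M5E -ltr_pdivlMr// div1r ltrBlDl ltr_pdivlMl// mulr1. Qed.

Definition theta_lo : R := (349 * 10 ^+ 4 + 812) / 10 ^+ 7.
Definition theta_hi : R := (349 * 10 ^+ 4 + 814) / 10 ^+ 7.

Lemma M5_theta_lo : M5_RRW theta_lo < 1.
Proof.
have [/andP[_ ln2_le] /andP[ln52_ge _]] := (ln2_itv, ln52_itv).
have t0 : 0 <= theta_lo by rewrite /theta_lo; lra.
have pow2_le : 2 `^ theta_lo <= 1 + thousandths [:: 273; 749; 170]%N.
  by apply: le_trans (powR_le_exp_horner 10 _ t0 ln2_le _) _;
    rewrite /theta_lo /thousandths/=; lra.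
have pow52_ge : 1 + thousandths [:: 376; 934; 790]%N <= (5 / 2) `^ theta_lo.
  have ln52_ge0_itv : 0 <= thousandths [:: 916; 290; 731; 800]%N <= ln (5 / 2).
    by rewrite ln52_ge andbT /thousandths/=; lra.
  by apply: le_trans (powR_ge_exp_horner 10 _ t0 ln52_ge0_itv);
    rewrite /theta_lo /thousandths/=; lra.
rewrite M5_lt1E.
move: pow2_le; rewrite -(ler_pM2r (powR52_gt0 theta_lo)).
by move: pow52_ge; rewrite /thousandths/=; lra.
Qed.

Lemma M5_theta_hi : 1 < M5_RRW theta_hi.
Proof.
have [/andP[ln2_ge _] /andP[_ ln52_le]] := (ln2_itv, ln52_itv).
have t0 : 0 <= theta_hi by rewrite /theta_hi; lra.
have pow2_ge : 1 + thousandths [:: 273; 749; 340; 800]%N <= 2 `^ theta_hi.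
  have ln2_ge0_itv : 0 <= thousandths [:: 693; 147; 180; 500]%N <= ln 2.
    by rewrite ln2_ge andbT /thousandths/=; lra.
  by apply: le_trans (powR_ge_exp_horner 10 _ t0 ln2_ge0_itv);
    rewrite /theta_hi /thousandths/=; lra.
have pow52_le : (5 / 2) `^ theta_hi <= 1 + thousandths [:: 376; 935; 51]%N.
  by apply: le_trans (powR_le_exp_horner 12 _ t0 ln52_le _) _;
    rewrite /theta_hi /thousandths/=; lra.
rewrite M5_gt1E.
move: pow2_ge; rewrite -(ler_pM2r (powR52_gt0 theta_hi)).
by move: pow52_le; rewrite /thousandths/=; lra.
Qed.

Lemma M5_root_exists : exists2 t, M5_RRW t = 1 & theta_lo < t < theta_hi.
Proof.
have lo_lt1 := M5_theta_lo; have hi_gt1 := M5_theta_hi.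
have lo_le_hi : theta_lo <= theta_hi by rewrite /theta_lo /theta_hi; lra.
have [||t /itvP t_itv Mt] := @IVT R (@M5_RRW R) _ _ 1 lo_le_hi.
- by apply: continuous_subspaceT => x; exact: continuous_M5.
- by rewrite /Order.min /Order.max (lt_trans lo_lt1 hi_gt1) !ltW.
exists t => //; rewrite !lt_neqAle !t_itv !andbT.
apply/andP; split; apply/eqP => eq_t; first by rewrite eq_t Mt ltxx in lo_lt1.
by rewrite -eq_t Mt ltxx in hi_gt1.
Qed.

Lemma theta_bounds (theta : R) : theta_lo < theta < theta_hi ->
  [/\ 0 < theta,
      `|theta - (349 * 10 ^+ 4 + 813) / 10 ^+ 7| < 10 ^- 7 &
      `|(1 - theta^-1) - (- (186 * 10 ^+ 3 + 466) / 10 ^+ 5)| < 10 ^- 5].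
Proof.
rewrite /theta_lo /theta_hi => /andP[lo hi].
have theta0 : 0 < theta by lra.
have inv_lt : theta^-1 < (2864 * 10 ^+ 3 + 665) / 10 ^+ 6.
  by rewrite -[ltLHS]div1r (ltr_pdivrMr _ _ theta0); lra.
have inv_gt : (2864 * 10 ^+ 3 + 655) / 10 ^+ 6 < theta^-1.
  by rewrite -[ltRHS]div1r (ltr_pdivlMr _ _ theta0); lra.
split; first exact: theta0.
  by rewrite ltr_norml; apply/andP; split; lra.
by rewrite ltr_norml; apply/andP; split; lra.
Qed.

End RootLocation.

Section Series.
Context {R : realType}.
Implicit Types (a s : R) (u : R ^nat) (f : (\bar R) ^nat).

Lemma riemannR_expR a n : riemannR a n = expR (- (a * ln n.+1%:R)).
Proof. by rewrite /riemannR /powR gt_eqF// expRN. Qed.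

(* Telescoping form of the integral test. *)
Lemma riemannR_telescope a n : 0 < a ->
  a * riemannR (1 + a) n.+1 <= riemannR a n - riemannR a n.+1.
Proof.
move=> a0; rewrite !riemannR_expR.
set u := ln n.+1%:R; set v := ln n.+2%:R.
have inv_le : n.+2%:R^-1 <= v - u.
  have := @le_ln1Dx R (- n.+2%:R^-1); rewrite ltrN2 invf_lt1// ltr1n.
  have -> : 1 + - n.+2%:R^-1 = n.+1%:R / n.+2%:R :> R.
    by rewrite -[X in X / _](addrK 1) natr1 mulrBl divff ?gt_eqF// mul1r.
  by rewrite ln_div ?posrE// => /(_ isT); rewrite lerNr opprB.
have -> : expR (- (a * u)) = expR (- (a * v)) * expR (a * (v - u)).
  by rewrite -expRD; congr expR; ring.
have -> : expR (- ((1 + a) * v)) = expR (- (a * v)) * n.+2%:R^-1.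
  by rewrite mulrDl mul1r opprD expRD mulrC [expR (- v)]expRN lnK ?posrE.
rewrite mulrCA -[X in _ - X]mulr1 -mulrBr ler_wpM2l ?expR_ge0//.
rewrite lerBrDl (le_trans _ (expR_ge1Dx _))// lerD2l.
by rewrite ler_wpM2l// ltW.
Qed.

Lemma is_cvg_riemannR a : 1 < a -> cvgn (series (riemannR a)).
Proof.
move=> a1; pose b := a - 1; have b0 : 0 < b by rewrite subr_gt0.
have riemannR_ge0 (c : R) n : 0 <= c -> 0 <= riemannR c n :> R.
  by move=> c0; rewrite ltW// riemannR_gt0.
have partial_sum_le n : b * series (riemannR a) n.+1 <= b + 1 - riemannR b n.
  elim: n => [|n IHn].
    by rewrite /series /= big_nat1 /riemannR !powR1 invr1 mulr1 addrK.
  rewrite seriesSr mulrDr; have := riemannR_telescope n b0.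
  rewrite subrKC; lra.
apply: nondecreasing_is_cvgn.
  apply: nondecreasing_series => n _ _.
  by rewrite riemannR_ge0// (le_trans ler01 (ltW a1)).
exists ((b + 1) / b) => _ [[|n] _ <-].
  by rewrite /series /= big_geq//; apply: divr_ge0; lra.
rewrite ler_pdivlMr// mulrC (le_trans (partial_sum_le n))//.
by rewrite gerBl riemannR_ge0// ltW.
Qed.

Lemma nneseries_le_cvg f u s : (forall n, 0 <= f n <= (u n)%:E)%E ->
  series u @ \oo --> s -> (\sum_(n <oo) f n <= s%:E)%E.
Proof.
move=> fu us; have f0 n : (0 <= f n)%E by case/andP: (fu n).
apply: lime_le; first exact: is_cvg_nneseries.
apply: nearW => N.
apply: (@le_trans _ _ (series u N)%:E).
  by rewrite /series /= -sumEFin; apply: lee_sum => n _; case/andP: (fu n).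
rewrite lee_fin -(cvg_lim _ us)//.
apply: nondecreasing_cvgn_le; last exact: cvgP us.
apply: nondecreasing_series => n _ _.
by rewrite -lee_fin; case/andP: (fu n) => /le_trans; apply.
Qed.

End Series.

Section AlmostEverywhere.
Context {d : measure_display} {T : measurableType d} {R : realType}.
Variable mu : {measure set T -> \bar R}.
Implicit Types (E : (set T) ^nat) (u : R ^nat) (f g : T -> \bar R).

Lemma measure_bigcup_le_series E u s : (forall n, measurable (E n)) ->
  (forall n, mu (E n) <= (u n)%:E)%E -> series u @ \oo --> s ->
  (mu (\bigcup_n E n) <= s%:E)%E.
Proof.
move=> mE Eu us.
have Eu' n : (0 <= mu (E n) <= (u n)%:E)%E by rewrite measure_ge0 Eu.
apply: le_trans (nneseries_le_cvg Eu' us).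
by apply: measure_sigma_subadditive => //; exact: bigcup_measurable.
Qed.

Lemma ae_eventually_notin E u : (forall n, measurable (E n)) ->
  (forall n, mu (E n) <= (u n)%:E)%E -> cvgn (series u) ->
  \forall w \ae mu, \forall n \near \oo, ~ E n w.
Proof.
move=> mE Eu us; exists (lim_sup_set E); split.
- by apply: bigcap_measurable => // n _; exact: bigcup_measurable.
- apply: lim_sup_set_cvg0 => //.
  have Eu' n : (0 <= mu (E n) <= (u n)%:E)%E by rewrite measure_ge0 Eu.
  exact: le_lt_trans (nneseries_le_cvg Eu' us) (ltry _).
- move=> w not_eventually N _; apply: contrapT => noE; apply: not_eventually.
  by exists N => // n Nn Enw; apply: noE; exists n.
Qed.

Lemma ae_lee_addgt0 f g :
  (forall e : R, 0 < e -> \forall w \ae mu, (f w <= g w + e%:E)%E) ->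
  \forall w \ae mu, (f w <= g w)%E.
Proof.
move=> fg.
have /ae_foralln : forall n, \forall w \ae mu, (f w <= g w + n.+1%:R^-1%:E)%E.
  by move=> n; apply: fg; rewrite invr_gt0.
apply: filterS => w fgw; apply/lee_addgt0Pr => e e0.
apply: le_trans (fgw (Num.truncn e^-1)) _; rewrite leeD2l// lee_fin.
by rewrite -[leRHS]invrK lef_pV2 ?posrE ?invr_gt0// ltW// truncnS_gt.
Qed.

Section FinitePreimage.
Variables (I : finType) (X : T -> I).
Hypothesis mX : forall i, measurable (X @^-1` [set i]).
Implicit Types A : {pred I}.

Lemma preimage_fin_bigcup A :
  [set w | X w \in A] = \bigcup_(i in [set` A]) X @^-1` [set i].
Proof. by apply/seteqP; split=> [w Aw|w [i Ai /= ->]]//; exists (X w). Qed.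

Lemma measurable_preimage_fin A : measurable [set w | X w \in A].
Proof. by rewrite preimage_fin_bigcup; exact: fin_bigcup_measurable. Qed.

Lemma measure_preimage_fin A :
  mu [set w | X w \in A] = (\sum_(i in A) mu (X @^-1` [set i]))%E.
Proof.
rewrite preimage_fin_bigcup measure_fin_bigcup//.
  by rewrite -(bigfs _ (index_enum_uniq I))// => i _; rewrite mem_index_enum.
exact: trivIset_preimage1.
Qed.

End FinitePreimage.

End AlmostEverywhere.

Section ExtendedReals.
Context {R : realType}.
Implicit Types (u v : (\bar R) ^nat) (c : \bar R).

Lemma limn_einf_ge u c :
  (\forall n \near \oo, (c <= u n)%E) -> (c <= limn_einf u)%E.
Proof.
move=> cu; rewrite [limn_einf u]limf_einfE.
apply: le_ereal_sup_tmp; exists (ereal_inf (u @` [set n | (c <= u n)%E])).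
  by exists [set n | (c <= u n)%E].
by apply: le_ereal_inf_tmp => _ [n cun <-].
Qed.

Lemma limn_einf_le u c :
  (forall N, exists2 n, (N <= n)%N & (u n <= c)%E) -> (limn_einf u <= c)%E.
Proof.
move=> uc; rewrite [limn_einf u]limf_einfE.
apply: ge_ereal_sup => _ [V [N _ NV] <-]; have [n Nn unc] := uc N.
by apply: ge_ereal_inf; exists (u n) => //; exists n => //; exact: NV.
Qed.

Lemma near_eq_limn_einf u v :
  (\forall n \near \oo, u n = v n) -> limn_einf u = limn_einf v.
Proof.
suff le_limn_einf u' v' : (\forall n \near \oo, u' n = v' n) ->
    (limn_einf u' <= limn_einf v')%E.
  move=> uv; apply/le_anti; rewrite !le_limn_einf//.
  by apply: filterS uv => n ->.
move=> uv; rewrite [limn_einf u']limf_einfE.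
apply: ge_ereal_sup => _ [V V_oo <-]; apply: limn_einf_ge.
near=> n; rewrite -(near uv n)//; apply: ereal_inf_lbound; exists n => //.
by near: n.
Unshelve. all: by end_near. Qed.

Lemma ereal_inf_expeR (A : set (\bar R)) :
  ereal_inf (expeR @` A) = expeR (ereal_inf A).
Proof.
apply/le_anti/andP; split; last first.
  apply: le_ereal_inf_tmp => _ [x Ax <-]; rewrite lee_expeR.
  exact: ereal_inf_lbound.
have inf_ge0 : (0 <= ereal_inf (expeR @` A))%E.
  by apply: le_ereal_inf_tmp => _ [x _ <-]; exact: expeR_ge0.
rewrite -[leLHS]lneK ?in_itv/= ?inf_ge0 ?leey// lee_expeR.
apply: le_ereal_inf_tmp => x Ax.
rewrite -lee_expeR lneK ?in_itv/= ?inf_ge0 ?leey//.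
by apply: ereal_inf_lbound; exists x.
Qed.

End ExtendedReals.

Section BinomialMode.
Context {R : realType}.
Implicit Types (p : R) (n b : nat).

Lemma binomial_pmfE n p b :
  binomial_pmf n p b = 'C(n, b)%:R * (p ^+ b * (1 - p) ^+ (n - b)).
Proof. by rewrite mulr_natl. Qed.

Lemma binomial_pmf_gt0 n p b : 0 < p < 1 -> (b <= n)%N ->
  0 < binomial_pmf n p b.
Proof.
move=> /andP[p0 p1] bn.
by rewrite binomial_pmfE !mulr_gt0 ?exprn_gt0 ?subr_gt0// ltr0n bin_gt0.
Qed.

Lemma sum_binomial_pmf n p : \sum_(b < n.+1) binomial_pmf n p b = 1.
Proof.
transitivity ((1 - p + p) ^+ n); last by rewrite subrK expr1n.
by rewrite exprDn; apply: eq_bigr => b _; rewrite binomial_pmfE mulr_natl mulrC.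
Qed.

Lemma binomial_pmfS n p b : (b < n)%N ->
  b.+1%:R * (1 - p) * binomial_pmf n p b.+1 =
  (n%:R - b%:R) * p * binomial_pmf n p b.
Proof.
move=> bn; rewrite !binomial_pmfE -natrB 1?ltnW// exprS.
have -> : (1 - p) ^+ (n - b) = (1 - p) * (1 - p) ^+ (n - b.+1).
  by rewrite -exprS -subSn.
have := congr1 (GRing.natmul (1 : R)) (mul_bin_left n b).
rewrite !natrM => binS.
transitivity (b.+1%:R * 'C(n, b.+1)%:R *
  ((1 - p) * p * p ^+ b * (1 - p) ^+ (n - b.+1))).
  by ring.
by rewrite binS; ring.
Qed.

(* The mode b is located by comparing its mass with those of its neighbours, and
   it carries at least the average mass 1/(n + 1). *)
Lemma binomial_mode n p : 0 < p < 1 -> exists b : nat,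
  [/\ (b <= n)%N, n.+1%:R * p - 1 <= b%:R <= n.+1%:R * p &
      n.+1%:R^-1 <= binomial_pmf n p b].
Proof.
move=> p01; have [p0 p1] := andP p01; have q0 : 0 < 1 - p by rewrite subr_gt0.
case: (@arg_maxP _ R 'I_n.+1 ord0 xpredT (binomial_pmf n p)) => // b _ bmax.
have bn : (b <= n)%N by rewrite -ltnS.
have mode_gt0 := binomial_pmf_gt0 p01 bn.
exists b; split => //; last first.
  rewrite -[leLHS]mul1r -[X in X / _](sum_binomial_pmf n p).
  rewrite ler_pdivrMr ?ltr0n// mulr_natr -[X in _ *+ X]card_ord -sumr_const.
  by apply: ler_sum => i _; exact: bmax.
apply/andP; split.
  have [bn'|nb] := ltnP b n; last first.
    have -> : b%:R = n%:R :> R by congr _%:R; apply/eqP; rewrite eqn_leq bn.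
    have := mulr_ge0 (ler0n R n.+1) (ltW q0); rewrite -natr1; lra.
  have := bmax (Ordinal (bn' : b.+1 < n.+1)%N) isT; rewrite /= => mode_max.
  have : (n%:R - b%:R) * p * binomial_pmf n p b
      <= b.+1%:R * (1 - p) * binomial_pmf n p b.
    by rewrite -binomial_pmfS// ler_wpM2l// mulr_ge0// ltW.
  by rewrite ler_pM2r// -[b.+1%:R]natr1 -[n.+1%:R]natr1; lra.
case: b bmax bn mode_gt0 => -[|c] /= cn bmax bn mode_gt0.
  by rewrite mulr_ge0// ltW.
have := bmax (Ordinal (ltnW cn)) isT; rewrite /= => mode_max.
have : c.+1%:R * (1 - p) * binomial_pmf n p c.+1
    <= (n%:R - c%:R) * p * binomial_pmf n p c.+1.
  rewrite binomial_pmfS// ler_wpM2l// mulr_ge0 ?(ltW p0)//.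
  by rewrite subr_ge0 ler_nat ltnW.
by rewrite ler_pM2r// -[c.+1%:R]natr1 -[n.+1%:R]natr1; lra.
Qed.

End BinomialMode.

Lemma sum_subsets_exprn (R : comPzSemiRingType) (I : finType) (x y : R) :
  \sum_(s : {set I}) x ^+ #|s| * y ^+ #|~: s|%SET = (x + y) ^+ #|I|.
Proof.
rewrite -prodr_const bigA_distr; apply: eq_big => [s|s _]; first by rewrite inE.
rewrite -!prodr_const [RHS](bigID (mem s)) /=; congr (_ * _).
  by apply: eq_bigr => i ->.
by apply: eq_big => [i|i]; rewrite inE// => /negbTE ->.
Qed.

Section Fall.
Context {R : realType}.
Implicit Types (x t : R) (k b : nat).

(* Minus the displacement after k steps of which b go up. *)
Definition fall k b : R := k%:R * ln 2 - b%:R * ln 5.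

Definition deep_sets k x : {set {set 'I_k}} :=
  [set s : {set 'I_k} | x <= fall k #|s|]%SET.

Lemma expR_fall k b t : (b <= k)%N ->
  expR (t * fall k b) = ((2 / 5) `^ t) ^+ b * (2 `^ t) ^+ (k - b).
Proof.
move=> bk; rewrite /powR !gt_eqF ?divr_gt0// -!expRM_natl -expRD; congr expR.
by rewrite /fall natrB// ln_div ?posrE//; ring.
Qed.

Lemma sum_expR_fall k t :
  \sum_(s : {set 'I_k}) expR (t * fall k #|s|) = (2 * M5_RRW t) ^+ k.
Proof.
rewrite /M5_RRW mulVKf// addrC -[X in _ ^+ X](card_ord k) -sum_subsets_exprn.
apply: eq_bigr => s _.
rewrite [#|~: s|%SET]cardsCs finset.setCK card_ord expR_fall//.
by rewrite -[leqRHS]card_ord max_card.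
Qed.

Lemma card_deep_sets_le k t x : 0 <= t ->
  #|deep_sets k x|%:R <= 2 ^+ k * (expR (- (t * x)) * M5_RRW t ^+ k).
Proof.
move=> t0; rewrite mulrCA -exprMn -sum_expR_fall mulr_sumr -sum1_card natr_sum.
rewrite big_mkcond; apply: ler_sum => s _; rewrite inE.
case: ifPn => [xs|_]; last by rewrite mulr_ge0 ?expR_ge0.
rewrite -expRD; apply: le_trans (expR_ge1Dx _).
by rewrite lerDl addrC -mulrBr mulr_ge0// subr_ge0.
Qed.

(* Probability of an upward step, and mean fall per step, under the law whose
   density is proportional to e^(t * fall). *)
Definition tilted_up t : R := 2^-1 * (2 / 5) `^ t / M5_RRW t.

Definition tilted_fall t : R := ln 2 - tilted_up t * ln 5.

Lemma tilted_up_gt0 t : 0 < tilted_up t.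
Proof. by rewrite divr_gt0 ?mulr_gt0 ?powR_gt0 ?M5_gt0//; lra. Qed.

Lemma subr1_tilted_up t : 1 - tilted_up t = 2^-1 * 2 `^ t / M5_RRW t.
Proof.
rewrite /tilted_up; apply: (canRL (mulfK _)); first by rewrite gt_eqF ?M5_gt0.
by rewrite mulrBl mulfVK ?gt_eqF ?M5_gt0// mul1r /M5_RRW; ring.
Qed.

Lemma tilted_up_lt1 t : tilted_up t < 1.
Proof.
by rewrite -subr_gt0 subr1_tilted_up divr_gt0 ?mulr_gt0 ?powR_gt0 ?M5_gt0.
Qed.

Lemma tilted_fallE t : tilted_fall t = M5_slope t / M5_RRW t.
Proof.
have M0 : M5_RRW t != 0 by rewrite gt_eqF ?M5_gt0.
apply: (canRL (mulfK M0)).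
rewrite /tilted_fall mulrBl mulrAC divfK//.
by rewrite /M5_slope /M5_RRW ln_div ?posrE//; ring.
Qed.

Lemma binomial_pmf_tilted_up k b t : (b <= k)%N ->
  binomial_pmf k (tilted_up t) b =
  'C(k, b)%:R * expR (t * fall k b) / (2 * M5_RRW t) ^+ k.
Proof.
move=> bk; rewrite binomial_pmfE subr1_tilted_up expR_fall// -[RHS]mulrA.
congr (_ * _).
have -> : (2 * M5_RRW t) ^- k =
    (2 * M5_RRW t)^-1 ^+ b * (2 * M5_RRW t)^-1 ^+ (k - b).
  by rewrite -exprD subnKC// exprVn.
rewrite [RHS]mulrACA -!exprMn ![_ * (2 * _)^-1]mulrC [(2 * _)^-1]invfM.
by congr (_ ^+ _ * _ ^+ _); rewrite mulrAC.
Qed.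

Lemma exists_typical_ups k t : exists b, [/\ (b <= k)%N,
  `|fall k b - k%:R * tilted_fall t| <= ln 5 &
  (2 * M5_RRW t) ^+ k / k.+1%:R <= 'C(k, b)%:R * expR (t * fall k b)].
Proof.
have p01 : 0 < tilted_up t < 1 by rewrite tilted_up_gt0 tilted_up_lt1.
have [b [bk /andP[b_ge b_le]]] := binomial_mode k p01.
rewrite binomial_pmf_tilted_up// => mass_ge; exists b; split => //.
  have ln5_gt0 : 0 < ln 5 :> R by apply: ln_gt0; lra.
  have -> : fall k b - k%:R * tilted_fall t =
      (k%:R * tilted_up t - b%:R) * ln 5.
    by rewrite /fall /tilted_fall; ring.
  rewrite normrM (gtr0_norm ln5_gt0) ler_piMl ?(ltW ln5_gt0)// ler_norml.
  by move: p01 b_ge b_le; rewrite -natr1; lra.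
by rewrite mulrC -ler_pdivlMr// exprn_gt0// mulr_gt0// M5_gt0.
Qed.

Definition typical_mass k t : R :=
  expR (- (t * (k%:R * tilted_fall t + ln 5))) / k.+1%:R.

Lemma typical_mass_gt0 k t : 0 < typical_mass k t.
Proof. by rewrite divr_gt0 ?expR_gt0. Qed.

(* Cramer's lower bound: keep only the sets of the most likely size under the
   tilted law, and undo the tilt. *)
Lemma card_deep_sets_ge k t : 0 <= t ->
  (2 * M5_RRW t) ^+ k * typical_mass k t
    <= #|deep_sets k (k%:R * tilted_fall t - ln 5)|%:R.
Proof.
move=> t0; have [b [bk]] := exists_typical_ups k t.
rewrite ler_norml => /andP[fall_ge fall_le] mass_ge.
rewrite /typical_mass [X in _ * X]mulrC mulrA.
apply: (@le_trans _ _ 'C(k, b)%:R).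
  apply: le_trans (_ : 'C(k, b)%:R * expR (t * fall k b) *
    expR (- (t * (k%:R * tilted_fall t + ln 5))) <= _).
    by rewrite ler_wpM2r ?expR_ge0.
  rewrite -mulrA -expRD ler_piMr// expR_le1 -mulrBr.
  by rewrite mulr_ge0_le0// subr_le0 addrC -lerBlDr.
rewrite ler_nat -{1}(card_ord k) -card_draws subset_leq_card//.
by apply/fintype.subsetP => s; rewrite !inE => /eqP ->; lra.
Qed.

End Fall.

Lemma mutually_independent_inj (R : realType) (d : measure_display)
    (T : measurableType d) (P : probability T R) (I : choiceType) (D : set I)
    (X : I -> {RV P >-> R}) (J : finType) (f : J -> I) (B : J -> set R) :
  mutually_independent D X -> injective f -> (forall j, D (f j)) ->
  (forall j, measurable (B j)) ->
  P (\bigcap_j X (f j) @^-1` B j) =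
    (\prod_j P (X (f j) @^-1` B j))%E.
Proof.
move=> indepX f_inj Df mB.
pose C i := \bigcap_(j in [set j | f j = i]) B j.
have CE j : C (f j) = B j.
  by apply/seteqP; split=> [x /(_ j erefl)|x Bx j' /f_inj ->].
pose imJ := [fset f j | j in J]%fset.
have -> : \bigcap_j X (f j) @^-1` B j = \bigcap_(i in [set` imJ]) X i @^-1` C i.
  apply/seteqP; split=> [w Xw _ /imfsetP[j _ ->]|w Xw j _]; rewrite /= ?CE.
    exact: Xw.
  by rewrite -CE; apply: Xw; rewrite /= in_imfset.
rewrite indepX => [|_ /imfsetP[j _ ->]|_ /imfsetP[j _ ->]]; rewrite ?CE//.
rewrite big_imfset /=; last by move=> ? ? _ _; exact: f_inj.
by rewrite big_enum; apply: eq_bigr => j _; rewrite CE.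
Qed.

Section Walks.
Context {R : realType} {d : measure_display} {T : measurableType d}.
Variables (P : probability T R) (delta : nat -> nat -> {RV P >-> R}).
Hypothesis hmodel : rrw_model delta.
Implicit Types (i k n : nat) (w : T).

Definition up_steps k n w : {set 'I_k} :=
  [set i : 'I_k | delta i.+1 n w == 1]%SET.

Definition depth k n w : R := fall k #|up_steps k n w|.

Lemma depth0 n w : depth 0 n w = 0.
Proof.
by rewrite /depth /fall (@eq_card0 _ (up_steps 0 n w)) ?mul0r ?subrr// => -[].
Qed.

Lemma ae_delta01 : \forall w \ae P, forall i n, (0 < i)%N -> (0 < n)%N ->
  delta i n w = 0 \/ delta i n w = 1.
Proof.
suff one_delta i n : \forall w \ae P,
    (0 < i)%N -> (0 < n)%N -> delta i n w = 0 \/ delta i n w = 1.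
  have := ae_foralln (fun i => ae_foralln (one_delta i)).
  by apply: filterS => w delta01 i n; exact: delta01.
have [/andP[i0 n0]|] := boolP ((0 < i) && (0 < n))%N; last first.
  by move=> /negP in0; apply: aeW => w i0 n0; case: in0; rewrite i0.
have [delta0 delta1] := hmodel.1 i n i0 n0.
have mdelta x := measurable_funPTI (delta i n) (measurable_set1 (x : R)).
exists (~` (delta i n @^-1` [set 0] `|` delta i n @^-1` [set 1])); split.
- by apply: measurableC; exact: measurableU.
- rewrite probability_setC; last exact: measurableU.
  rewrite measureU//; last first.
    rewrite -preimage_setI (_ : [set 0] `&` [set 1] = set0) ?preimage_set0//.
    by apply/seteqP; split => // x [/= ->] /eqP; rewrite eq_sym oner_eq0.
  rewrite [X in (_ - (X + _))%E]delta0 [X in (_ - (_ + X))%E]delta1.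
  by rewrite -EFinD -[2^-1]div1r -splitr subrr.
- move=> w /=; apply: contra_not => delta01 _ _; exact: delta01.
Qed.

Lemma ae_Z5E : \forall w \ae P, forall k n, (0 < n)%N ->
  Z5 delta k n w = ln n%:R - depth k n w.
Proof.
move: ae_delta01; apply: filterS => w delta01 k n n0.
have card_up : #|up_steps k n w|%:R = \sum_(i < k) delta i.+1 n w.
  rewrite -sum1_card natr_sum big_mkcond; apply: eq_bigr => i _; rewrite inE.
  by case: (delta01 i.+1 n isT n0) => ->; rewrite ?eqxx// eq_sym oner_eq0.
rewrite /Z5 big_add1 /= big_mkord /depth /fall card_up big_split /=.
by rewrite sumr_const card_ord mulNrn [k%:R * _]mulr_natl mulr_suml opprB addrC.
Qed.

Definition eq1_set (b : bool) : set R := if b then [set 1] else ~` [set 1].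

Lemma eq1_setP x b : eq1_set b x <-> (x == 1) = b.
Proof.
case: b => /=; first by split=> /eqP.
by split=> [/eqP/negbTE|/negbT/eqP].
Qed.

Lemma measurable_eq1_set b : measurable (eq1_set b).
Proof. by case: b; [exact: measurable_set1|exact: measurableC]. Qed.

Lemma prob_delta_eq1 i n b : (0 < i)%N -> (0 < n)%N ->
  P (delta i n @^-1` eq1_set b) = (2^-1)%:E.
Proof.
move=> i0 n0; have [_ delta1] := hmodel.1 i n i0 n0; case: b => //.
rewrite /eq1_set -preimage_setC probability_setC; last exact: measurable_funPTI.
by rewrite [X in (_ - X)%E]delta1 -EFinB {1}[1]splitr div1r addrK.
Qed.

Section Configurations.
Variables (k : nat) (J : finType) (start : J -> nat).

Definition config w : {ffun J -> {set 'I_k}} :=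
  [ffun j => up_steps k (start j) w].

Lemma config_cylinder phi : config @^-1` [set phi] =
  \bigcap_(u : 'I_k * J)
    delta u.1.+1 (start u.2) @^-1` eq1_set (u.1 \in phi u.2).
Proof.
apply/seteqP; split=> [w <- [i j] _|w delta_phi]; rewrite /=.
  by apply/eq1_setP; rewrite ffunE inE.
apply/ffunP => j; rewrite ffunE; apply/setP => i; rewrite inE.
exact/eq1_setP/(delta_phi (i, j)).
Qed.

Lemma measurable_config phi : measurable (config @^-1` [set phi]).
Proof.
rewrite config_cylinder; apply: fin_bigcap_measurable => [|u _].
  exact: finite_finset.
by apply: measurable_funPTI; exact: measurable_eq1_set.
Qed.

Implicit Types F : J -> {set {set 'I_k}}.

Lemma up_steps_family F : [set w | forall j, up_steps k (start j) w \in F j] =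
  [set w | config w \in family (fun j => mem (F j))].
Proof.
apply/seteqP; split=> w /= configF.
  by apply/familyP => j; rewrite ffunE; exact: configF.
by move=> j; have /familyP/(_ j) := configF; rewrite ffunE.
Qed.

Lemma measurable_up_steps F :
  measurable [set w | forall j, up_steps k (start j) w \in F j].
Proof.
rewrite up_steps_family; apply: measurable_preimage_fin.
exact: measurable_config.
Qed.

Hypothesis start_inj : injective start.
Hypothesis start_gt0 : forall j, (0 < start j)%N.

Lemma prob_config phi :
  P (config @^-1` [set phi]) = (2^-1 ^+ (k * #|J|))%:E.
Proof.
pose index (u : 'I_k * J) := (u.1.+1, start u.2).
rewrite config_cylinder.
have := @mutually_independent_inj _ _ _ _ _ _ _ _ index
  (fun u => eq1_set (u.1 \in phi u.2)) hmodel.2.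
rewrite /index /= => ->.
- under eq_bigr do rewrite prob_delta_eq1//.
  by rewrite prodEFin prodr_const card_prod card_ord.
- by move=> [i j] [i' j'] [/val_inj -> /start_inj ->].
- by move=> u; split.
- by move=> u; exact: measurable_eq1_set.
Qed.

Lemma prob_up_steps F : P [set w | forall j, up_steps k (start j) w \in F j] =
    (\prod_j (#|F j|%:R / 2 ^+ k))%:E.
Proof.
rewrite up_steps_family (measure_preimage_fin _ measurable_config).
rewrite (eq_bigr _ (fun phi _ => prob_config phi)) sumEFin sumr_const.
rewrite card_family foldrE big_map big_enum; congr EFin.
rewrite -[LHS]mulr_natl natr_prod exprM -prodr_const.
by rewrite -big_split; apply: eq_bigr => j _; rewrite exprVn.
Qed.

End Configurations.

Lemma depth_ge_up_steps k n x : [set w | x <= depth k n w] =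
  [set w | forall _ : 'I_1, up_steps k n w \in deep_sets k x].
Proof.
by apply/seteqP; split=> w /= => [xw _|/(_ ord0)]; rewrite inE.
Qed.

Lemma measurable_depth_ge k n x : measurable [set w | x <= depth k n w].
Proof. by rewrite depth_ge_up_steps; exact: measurable_up_steps. Qed.

Lemma prob_depth_ge k n t x : (0 < n)%N -> 0 <= t ->
  (P [set w | x <= depth k n w]%R <= (expR (- (t * x)) * M5_RRW t ^+ k)%:E)%E.
Proof.
move=> n0 t0; rewrite depth_ge_up_steps prob_up_steps// => [|i j _].
  by rewrite big_ord1 lee_fin ler_pdivrMr ?exprn_gt0// mulrC card_deep_sets_le.
by rewrite !ord1.
Qed.

Lemma ever_depth_ge_bigcup n x : [set w | exists k, x <= depth k n w] =
  \bigcup_k [set w | x <= depth k n w].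
Proof. by apply/seteqP; split=> w [k]; exists k. Qed.

Lemma measurable_ever_depth_ge n x :
  measurable [set w | exists k, x <= depth k n w].
Proof.
rewrite ever_depth_ge_bigcup; apply: bigcup_measurable => k _.
exact: measurable_depth_ge.
Qed.

Lemma prob_ever_depth_ge n t x : (0 < n)%N -> 0 <= t -> M5_RRW t < 1 ->
  (P [set w | exists k, x <= depth k n w]%R <=
    (expR (- (t * x)) / (1 - M5_RRW t))%:E)%E.
Proof.
move=> n0 t0 M1; rewrite ever_depth_ge_bigcup.
apply: (@measure_bigcup_le_series _ _ _ _ _
  (geometric (expR (- (t * x))) (M5_RRW t))).
- by move=> k; exact: measurable_depth_ge.
- by move=> k; exact: prob_depth_ge.
- by apply: cvg_geometric_series; rewrite gtr0_norm ?M5_gt0.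
Qed.

Lemma measurable_all_depth_lt k (J : finType) (start : J -> nat) x :
  measurable [set w | forall j, depth k (start j) w < x].
Proof.
rewrite (_ : [set w | _] = \bigcap_j ~` [set w | x <= depth k (start j) w]).
  apply: fin_bigcap_measurable => [|j _]; first exact: finite_finset.
  by apply: measurableC; exact: measurable_depth_ge.
apply/seteqP; split=> w /= depth_lt j.
  by move=> _ /=; rewrite leNgt depth_lt.
by rewrite ltNge; apply/negP; exact: (depth_lt j I).
Qed.

Lemma prob_all_depth_lt k (J : finType) (start : J -> nat) t :
  injective start -> (forall j, (0 < start j)%N) -> 0 <= t -> M5_RRW t = 1 ->
  (P [set w | forall j, depth k (start j) w < k%:R * tilted_fall t - ln 5]%R <=
    (expR (- (#|J|%:R * typical_mass k t)))%:E)%E.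
Proof.
move=> start_inj start_gt0 t0 Mt; set x := _ - ln 5.
pose F := deep_sets k x.
rewrite (_ : [set w | _] =
    [set w | forall j, up_steps k (start j) w \in (~: F)%SET]); last first.
  by apply/seteqP; split=> w /= lt_x j; have := lt_x j; rewrite !inE -ltNge.
rewrite prob_up_steps// prodr_const lee_fin -mulrN expRM_natl.
rewrite lerXn2r ?nnegrE ?divr_ge0 ?expR_ge0//.
apply: le_trans (expR_ge1Dx _); rewrite ler_pdivrMr ?exprn_gt0//.
have := card_deep_sets_ge k t0; rewrite -/x -/F Mt mulr1 => F_ge.
have cardF : #|F|%:R + #|(~: F)%SET|%:R = 2 ^+ k :> R.
  rewrite -natrD cardsC -cardsT -powersetT card_powerset cardsT card_ord.
  by rewrite natrX.
by move: F_ge cardF; lra.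
Qed.

End Walks.

Section BlockStart.
Context {R : realType}.
Implicit Types (b h t : R) (k N : nat).

(* The walks started in [block_start b k, 2 * block_start b k[ are about
   e^(k b) independent walks whose starting points have logarithm about k b. *)
Definition block_start b k : nat := (Num.truncn (expR (k%:R * b))).+1.

Lemma expR_lt_block_start b k : expR (k%:R * b) < (block_start b k)%:R.
Proof. exact: truncnS_gt. Qed.

Lemma near_le_block_start b N : 0 < b ->
  \forall k \near \oo, (N <= block_start b k)%N.
Proof.
move=> b0; near=> k.
have Nk : N%:R / b <= k%:R by near: k; exact: nbhs_infty_ger.
rewrite -(ler_nat R) (le_trans _ (ltW (expR_lt_block_start b k)))//.
by rewrite (le_trans _ (expR_ge1Dx _))// (le_trans (_ : _ <= k%:R * b))
  ?lerDr// -ler_pdivrMr.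
Unshelve. all: by end_near. Qed.

Lemma ln_block_le b k (j : 'I_(block_start b k)) : 0 <= b ->
  ln (block_start b k + j)%:R <= k%:R * b + ln 4.
Proof.
move=> b0; rewrite -ler_expR expRD !lnK ?posrE ?ltr0n//.
have exp_ge1 : 1 <= expR (k%:R * b) by rewrite -expR0 ler_expR mulr_ge0.
have trunc_le : (Num.truncn (expR (k%:R * b)))%:R <= expR (k%:R * b).
  by rewrite truncn_le expR_ge0.
have start_le : (block_start b k)%:R <= 2 * expR (k%:R * b).
  by rewrite /block_start -natr1; lra.
apply: (@le_trans _ _ ((block_start b k)%:R + (block_start b k)%:R)).
  by rewrite natrD lerD2l ler_nat ltnW.
by lra.
Qed.

Lemma expRN_block_mass_le_geometric b h t k :
  0 < h -> t * tilted_fall t + h + h <= b ->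
  expR (- ((block_start b k)%:R * typical_mass k t)) <=
  geometric (expR (t * ln 5) * (1 + h^-1)) (expR (- h)) k.
Proof.
set mu := tilted_fall t => h0 hb; have mass_gt0 := typical_mass_gt0 k t.
apply: le_trans (expRN_le_inv _) _; first by rewrite mulr_gt0.
have mass_ge : expR (k%:R * (t * mu + h + h)) * typical_mass k t <=
    (block_start b k)%:R * typical_mass k t.
  rewrite ler_pM2r// (le_trans _ (ltW (expR_lt_block_start b k)))//.
  by rewrite ler_expR ler_wpM2l.
move: mass_ge; rewrite -lef_pV2 ?posrE ?mulr_gt0 ?expR_gt0//.
move=> /le_trans; apply.
rewrite /typical_mass mulrA -expRD invf_div ler_pdivrMr ?expR_gt0// -/mu.
apply: (le_trans (natS_le_expR k h0)); rewrite /geometric /= -expRM_natl.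
have -> : k%:R * h = t * ln 5 + k%:R * - h +
    (k%:R * (t * mu + h + h) - t * (k%:R * mu + ln 5)) by ring.
by rewrite !expRD !mulrA [(1 + _) * _]mulrC.
Qed.

End BlockStart.

Section WalkInfimum.
Context {R : realType} {d : measure_display} {T : measurableType d}.
Variables (P : probability T R) (delta : nat -> nat -> {RV P >-> R}).
Implicit Types (n : nat) (w : T) (c : R).

Definition scaled_inf n w : \bar R :=
  ereal_inf [set (Z5 delta k n w / ln n%:R)%:E | k in [set: nat]].

Lemma lne_t_minus_div n w : (1 < n)%N ->
  (lne (t_minus delta n w) / (ln n%:R)%:E)%E = scaled_inf n w.
Proof.
move=> n1; have lnn0 : 0 < ln n%:R :> R by rewrite ln_gt0// ltr1n.
have -> : t_minus delta n w =
    expeR (ereal_inf [set (Z5 delta k n w)%:E | k in [set: nat]]).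
  by rewrite -ereal_inf_expeR image_comp.
rewrite expeRK inver gt_eqF// muleC -ereal_inf_pZl ?invr_gt0// image_comp.
by under eq_imagel do rewrite /= -EFinM mulrC.
Qed.

Lemma t_minus_gt0 n w c : (forall k, c <= Z5 delta k n w) ->
  (0 < t_minus delta n w)%E.
Proof.
move=> Z5_ge; apply: (@lt_le_trans _ _ (expR c)%:E).
  by rewrite lte_fin expR_gt0.
by apply: le_ereal_inf_tmp => _ [k _ <-]; rewrite lee_fin ler_expR.
Qed.

Lemma t_minus_lty n w : (t_minus delta n w < +oo)%E.
Proof.
apply: le_lt_trans (ltry (expR (Z5 delta 0 n w))).
by apply: ereal_inf_lbound; exists 0%N.
Qed.

End WalkInfimum.

Section AlmostSure.
Context {R : realType} {d : measure_display} {T : measurableType d}.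
Variables (P : probability T R) (delta : nat -> nat -> {RV P >-> R}).
Hypothesis hmodel : rrw_model delta.
Variable theta : R.
Hypotheses (theta_gt0 : 0 < theta) (Mtheta : M5_RRW theta = 1).
Implicit Types (k n N : nat) (w : T) (g b : R).

Local Notation depth := (depth delta).

Lemma ae_eventually_depth_lt (start : nat -> nat) g :
  (forall i, (0 < start i)%N) -> theta^-1 < g ->
  \forall w \ae P, \forall i \near \oo,
    forall k, depth k (start i) w < g * ln i.+1%:R.
Proof.
move=> start_gt0 thetaVg.
have g0 : 0 < g by apply: lt_trans thetaVg; rewrite invr_gt0.
have gV_lt : g^-1 < theta by rewrite -[ltRHS]invrK ltf_pV2 ?posrE ?invr_gt0.
pose t := (g^-1 + theta) / 2.
have [gVt t_lt] : g^-1 < t /\ t < theta by rewrite /t; split; lra.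
have t0 : 0 < t by apply: lt_trans gVt; rewrite invr_gt0.
have tg : 1 < t * g by rewrite -ltr_pdivrMr// div1r.
have Mt : M5_RRW t < 1 by apply: M5_lt1 Mtheta _; rewrite t0.
pose E i := [set w | exists k, g * ln i.+1%:R <= depth k (start i) w].
have PE i : (P (E i) <= (((1 - M5_RRW t)^-1 *: riemannR (t * g)) i)%:E)%E.
  apply: le_trans (prob_ever_depth_ge hmodel _ (start_gt0 i) (ltW t0) Mt) _.
  rewrite lee_fin mulrC mulrA -riemannR_expR; exact: lexx.
have mE i : measurable (E i) by exact: measurable_ever_depth_ge.
have := ae_eventually_notin mE PE (is_cvg_seriesZ (is_cvg_riemannR tg)).
apply: filterS => w; apply: filterS => i notE k.
by rewrite ltNge; apply/negP => depth_ge; apply: notE; exists k.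
Qed.

Lemma ae_eventually_block_depth_ge b : theta * tilted_fall theta < b ->
  \forall w \ae P, \forall k \near \oo, exists j : 'I_(block_start b k),
    k%:R * tilted_fall theta - ln 5 <= depth k (block_start b k + j) w.
Proof.
set mu := tilted_fall theta => mub.
pose h := (b - theta * mu) / 2; have h0 : 0 < h by rewrite divr_gt0 ?subr_gt0.
pose E k := [set w | forall j : 'I_(block_start b k),
  depth k (block_start b k + j) w < k%:R * mu - ln 5].
have mE k : measurable (E k) by exact: measurable_all_depth_lt.
pose c := expR (theta * ln 5) * (1 + h^-1).
have PE k : (P (E k) <= (geometric c (expR (- h)) k)%:E)%E.
  apply: le_trans (prob_all_depth_lt hmodel (t := theta) _ _ _ _ _) _ => //.
  - by move=> i j /addnI /val_inj.
  - exact: ltW.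
  rewrite lee_fin card_ord; apply: expRN_block_mass_le_geometric => //.
  by rewrite -/mu /h; lra.
have ratio_lt1 : `|expR (- h)| < 1.
  by rewrite gtr0_norm ?expR_gt0// expR_lt1 oppr_lt0.
have := ae_eventually_notin mE PE (is_cvg_geometric_series ratio_lt1).
apply: filterS => w; apply: filterS => k notE; apply: contrapT => no_deep.
apply: notE => j; rewrite ltNge; apply/negP => deep; apply: no_deep.
by exists j.
Qed.

Lemma ae_infinitely_often_depth_ge g : g < theta^-1 ->
  \forall w \ae P, forall N, exists2 n, (N <= n)%N &
    exists k, g * ln n%:R <= depth k n w.
Proof.
move=> g_lt; have [g_lt0|g0] := ltP g 0.
  apply: aeW => w N; exists N.+1 => //; exists 0%N.
  by rewrite depth0 mulr_le0_ge0 ?(ltW g_lt0)// ln_ge0// ler1n.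
pose mu := tilted_fall theta.
have mu0 : 0 < mu by rewrite /mu tilted_fallE Mtheta divr1 M5_slope_gt0.
pose h := (g + theta^-1) / 2; have [gh h_lt] : g < h /\ h < theta^-1.
  by rewrite /h; split; lra.
have h0 : 0 < h by exact: le_lt_trans gh.
pose b := mu / h; have b0 : 0 < b by exact: divr_gt0.
have mub : theta * mu < b.
  by rewrite /b mulrC ltr_pM2l// -[ltLHS]invrK ltf_pV2 ?posrE ?invr_gt0.
have gb : g * b < mu by rewrite /b mulrCA gtr_pMr// ltr_pdivrMr// mul1r.
have := ae_eventually_block_depth_ge mub; apply: filterS => w deep N.
near \oo => k.
have [j deep_j] : exists j : 'I_(block_start b k),
    k%:R * mu - ln 5 <= depth k (block_start b k + j) w by near: k.
have Nk : (N <= block_start b k)%N by near: k; exact: near_le_block_start.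
have k_large : (ln 5 + g * ln 4) / (mu - g * b) <= k%:R.
  by near: k; exact: nbhs_infty_ger.
exists (block_start b k + j)%N; first exact: leq_trans Nk (leq_addr _ _).
exists k; apply: le_trans deep_j.
have := ler_wpM2l g0 (ln_block_le j (ltW b0)).
by move: k_large; rewrite ler_pdivrMr ?subr_gt0//; lra.
Unshelve. all: by end_near. Qed.

Lemma ae_t_minus_gt0 :
  \forall w \ae P, forall n, (0 < n)%N -> (0 < t_minus delta n w)%E.
Proof.
suff each_n n : \forall w \ae P, (0 < t_minus delta n.+1 w)%E.
  by have := ae_foralln each_n; apply: filterS => w t_gt0 [|n].
have thetaV_lt : theta^-1 < theta^-1 + 1 by rewrite ltrDl.
have := ae_eventually_depth_lt (fun=> ltn0Sn n) thetaV_lt.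
apply: filterS2 (ae_Z5E hmodel) => w Z5E /filter_ex[i depth_lt].
apply: (t_minus_gt0 (c := ln n.+1%:R - (theta^-1 + 1) * ln i.+1%:R)) => k.
by rewrite Z5E// lerB// ltW.
Qed.

Lemma ae_limn_einf_scaled_ge : \forall w \ae P,
  ((1 - theta^-1)%:E <= limn_einf (scaled_inf delta ^~ w))%E.
Proof.
apply: ae_lee_addgt0 => e e0.
have thetaV_lt : theta^-1 < theta^-1 + e by rewrite ltrDl.
have := ae_eventually_depth_lt ltn0Sn thetaV_lt.
apply: filterS2 (ae_Z5E hmodel) => w Z5E [N _ depth_lt].
rewrite -leeBlDr// -EFinB; apply: limn_einf_ge.
exists N.+2 => // -[//|n] Nn; apply: le_ereal_inf_tmp => _ [k _ <-].
have lnn0 : 0 < ln n.+1%:R :> R by rewrite ln_gt0// ltr1n (leq_trans _ Nn).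
rewrite lee_fin ler_pdivlMr// Z5E//.
by have := depth_lt n (ltnW Nn) k; lra.
Qed.

Lemma ae_limn_einf_scaled_le : \forall w \ae P,
  (limn_einf (scaled_inf delta ^~ w) <= (1 - theta^-1)%:E)%E.
Proof.
apply: ae_lee_addgt0 => e e0.
have lt_thetaV : theta^-1 - e < theta^-1 by rewrite gtrBl.
have := ae_infinitely_often_depth_ge lt_thetaV.
apply: filterS2 (ae_Z5E hmodel) => w Z5E deep.
rewrite -EFinD; apply: limn_einf_le => N.
have [n Nn [k depth_ge]] := deep N.+2; exists n; first exact: ltnW (ltnW Nn).
apply: ge_ereal_inf; exists (Z5 delta k n w / ln n%:R)%:E; first by exists k.
have lnn0 : 0 < ln n%:R :> R by rewrite ln_gt0// ltr1n (leq_trans _ Nn).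
rewrite lee_fin ler_pdivrMr// Z5E ?(leq_trans _ Nn)//.
by move: depth_ge; lra.
Qed.

End AlmostSure.

(* The quotients by log n are junk for n = 0, 1, which no liminf sees. The
   decimals 0.3490813 and -1.86466 are split to avoid large unary numerals;
   0.3490813 is a truncation (theta_star = 0.34908136...), so both
   approximations are stated up to one unit in the last displayed digit. *)
Theorem theorem8p4 (R : realType) (d : measure_display) (T : measurableType d)
    (P : probability T R) (delta : nat -> nat -> {RV P >-> R})
    (hmodel : rrw_model delta) :
  (\forall w \ae P, forall n : nat, (0 < n)%N ->
     (0 < t_minus delta n w < +oo)%E) /\
  exists theta_star : R,
    [/\ 0 < theta_star,
        forall theta : R,
          M5_RRW theta = 1 <-> theta = 0 \/ theta = theta_star,
        `|theta_star - (349 * 10 ^+ 4 + 813) / 10 ^+ 7| < 10 ^- 7,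
        `|(1 - theta_star^-1) - (- (186 * 10 ^+ 3 + 466) / 10 ^+ 5)| < 10 ^- 5 &
        \forall w \ae P,
          limn_einf (fun n : nat =>
            lne (t_minus delta n w) / (ln n%:R)%:E)%E
            = (1 - theta_star^-1)%:E /\
          limn_einf (fun n : nat =>
            ereal_inf [set (Z5 delta k n w / ln n%:R)%:E | k in [set: nat]])
            = (1 - theta_star^-1)%:E].
Proof.
have [theta Mtheta /theta_bounds[theta0 approx inv_approx]] :=
  @M5_root_exists R.
split.
  have := ae_t_minus_gt0 hmodel theta0 Mtheta; apply: filterS => w t_gt0 n n0.
  by rewrite t_gt0// t_minus_lty.
exists theta; split => //; first exact: M5_roots.
have := ae_limn_einf_scaled_ge hmodel theta0 Mtheta.
apply: filterS2 (ae_limn_einf_scaled_le hmodel theta0 Mtheta) =>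
  w liminf_le liminf_ge.
have liminfE : limn_einf (scaled_inf delta ^~ w) = (1 - theta^-1)%:E.
  by apply/le_anti; rewrite liminf_le liminf_ge.
split=> //; rewrite -[RHS]liminfE; apply: near_eq_limn_einf.
by exists 2 => // n n1; exact: lne_t_minus_div.
Qed.
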